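(* Let $p$ be an odd prime and let $k=\frac{p-1}{2}$. Then for all $a\in\mathbb{Z}$, $$\left(\frac{a}{p}\right)_{k}=\begin{cases}1, & \text{if } \left(\frac{a}{p}\right)=1,\\ -1, & \text{if } \left(\frac{a}{p}\right)=-1,\\ 0, & \text{if } a\equiv 0\pmod p,\end{cases}$$ where $\left(\frac{a}{p}\right)$ (without subscript) is the classical Legendre symbol.
   Context: For an odd prime $p$, an integer $k\ge 1$ and $a\in\mathbb{Z}$, the exponential congruence symbol $\left(\frac{a}{p}\right)_k\in\{-1,0,1\}$ (with subscript $k$) is defined to be $1$ if $a^k\equiv 1\pmod p$, $-1$ if $a^k\equiv -1\pmod p$, and $0$ otherwise. *)

(* Defs.v *)
From mathcomp Require Import all_boot all_order all_algebra.
Set Implicit Arguments.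
Unset Strict Implicit.
Unset Printing Implicit Defensive.
Import Order.TTheory GRing.Theory Num.Theory.
Local Open Scope ring_scope.

(* If a ^ k is congruent to both 1 and -1, then p divides 2; the order of the
   tests is therefore irrelevant for an odd prime p. *)
Definition exp_symbol (a : int) (p k : nat) : int :=
  if (a ^+ k == 1 %[mod p])%Z then 1
  else if (a ^+ k == -1 %[mod p])%Z then -1
  else 0.

(* The search for a square root may be restricted to 0 <= x < p, which makes
   the notion decidable; [is_square_modP] gives the form over the integers. *)
Definition is_square_mod (a : int) (p : nat) : bool :=
  [exists x : 'I_p, (x%:Z ^+ 2 == a %[mod p])%Z].

Lemma is_square_modP (a : int) (p : nat) : (0 < p)%N ->
  reflect (exists x : int, (x ^+ 2 = a %[mod p])%Z) (is_square_mod a p).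
Proof.
move=> p_gt0; apply: (iffP existsP) => [[x /eqP Hx]|[x Hx]].
  by exists x%:Z.
have p_neq0 : p%:Z != 0 by rewrite eqz_nat -lt0n.
have r_ge0 : 0 <= (x %% p)%Z by rewrite modz_ge0.
have r_ltp : (`|(x %% p)%Z| < p)%N.
  by rewrite -ltz_nat gez0_abs // ltz_pmod // ltz_nat.
exists (Ordinal r_ltp); apply/eqP.
by rewrite /= gez0_abs // modzXm.
Qed.

Definition legendre (a : int) (p : nat) : int :=
  if (p %| a)%Z then 0 else if is_square_mod a p then 1 else -1.

(* Main.v *)
(** The symbol is Euler's criterion, read in the field [F_p]. With [g] a
    primitive root of order [p - 1 = 2k] and [x = g ^ i], one has [x ^ k = 1]
    exactly when [2k] divides [ik], that is when [i] is even and [x] is a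
    square; otherwise [x ^ k = -1], because [x ^ k] is a square root of
    [x ^ (p - 1) = 1]. *)
Require Import Defs.
From mathcomp Require Import all_boot all_order all_algebra.
From mathcomp Require Import cyclic finfield.
Set Implicit Arguments.
Unset Strict Implicit.
Unset Printing Implicit Defensive.
Import Order.TTheory GRing.Theory Num.Theory.
Local Open Scope ring_scope.

Lemma expf_card_pred (F : finFieldType) (x : F) : x != 0 -> x ^+ #|F|.-1 = 1.
Proof.
move=> x_neq0; apply: (mulfI x_neq0).
by rewrite mulr1 -exprS prednK ?expf_card // ltnW ?finNzRing_gt1.
Qed.

(** The nonzero elements are [#|F|.-1] distinct roots of unity of order dividing [#|F|.-1]; in a
    field, that many force a primitive one among them. *)
Lemma finField_prim_root (F : finFieldType) :
  exists g : F, #|F|.-1.-primitive_root g.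
Proof.
have cardF_gt0 : (0 < #|F|.-1)%N by rewrite -subn1 subn_gt0 finNzRing_gt1.
suff /hasP[g _ g_prim] : has #|F|.-1.-primitive_root (enum (predC1 (0 : F))).
  by exists g.
apply: has_prim_root => //; first apply/allP => x.
- by rewrite mem_enum => /expf_card_pred; rewrite unity_rootE => ->.
- exact: enum_uniq.
- by rewrite -cardE cardC1.
Qed.

Lemma finField_sqrtP (F : finFieldType) (k : nat) (x : F) :
  #|F|.-1 = k.*2 -> x != 0 -> reflect (exists y, y ^+ 2 = x) (x ^+ k == 1).
Proof.
move=> cardF x_neq0; apply: (iffP eqP) => [xk1|[y y2x]].
  have [g g_prim] := finField_prim_root F.
  have [[i _] /= def_x] := prim_rootP g_prim (expf_card_pred x_neq0).
  have k_gt0 : (0 < k)%N by rewrite -double_gt0 -cardF (prim_order_gt0 g_prim).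
  move/eqP: xk1; rewrite def_x -exprM -(prim_order_dvd g_prim) cardF -mul2n.
  (* Cancelling [k] from [2 * k %| i * k] leaves [i = j * 2], so [g ^+ j] is a square root. *)
  by rewrite dvdn_pmul2r // => /dvdnP[j ->]; exists (g ^+ j); rewrite exprM.
have y_neq0 : y != 0 by rewrite -sqrf_eq0 y2x.
by rewrite -y2x -exprM mul2n -cardF expf_card_pred.
Qed.

Lemma finField_expf_half (F : finFieldType) (k : nat) (x : F) :
  #|F|.-1 = k.*2 -> x != 0 -> (x ^+ k == 1) || (x ^+ k == -1).
Proof.
move=> cardF x_neq0.
by rewrite -sqrf_eq1 -exprM muln2 -cardF expf_card_pred.
Qed.

(** Carries congruences over to ['F_p]: as [p] is its characteristic, [p] divides [m - n] exactly
    when the image of [m - n] vanishes. *)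
Lemma eqz_mod_Fp (p : nat) (m n : int) : prime p ->
  (m == n %[mod p])%Z = (m%:~R == n%:~R :> 'F_p).
Proof.
move=> /pchar_Fp p_char.
by rewrite eqz_mod_dvd (dvdz_pcharf p_char) rmorphB subr_eq0.
Qed.

Lemma is_square_mod_Fp (a : int) (p : nat) : prime p ->
  reflect (exists y : 'F_p, y ^+ 2 = a%:~R) (is_square_mod a p).
Proof.
move=> p_prime; apply: (iffP (is_square_modP a (prime_gt0 p_prime))).
  move=> [x /eqP]; rewrite eqz_mod_Fp // rmorphXn => /eqP x2a.
  by exists x%:~R.
(* The canonical representative of [y] lifts the root to the integers. *)
move=> [y y2a]; exists (y : nat)%:Z; apply/eqP.
by rewrite eqz_mod_Fp // rmorphXn /= -pmulrn natr_Zp y2a.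
Qed.

Theorem theorem3p1 (p k : nat) (p_prime : prime p) (p_odd : odd p)
    (def_k : k = (p.-1 %/ 2)%N) (a : int) :
  [/\ legendre a p = 1 -> exp_symbol a p k = 1,
      legendre a p = -1 -> exp_symbol a p k = -1
    & (a = 0 %[mod p])%Z -> exp_symbol a p k = 0].
Proof.
have p_gt2 : (2 < p)%N by rewrite odd_prime_gt2.
have pred_p : p.-1 = k.*2.
  (* As [p] is odd, [p.-1] is even and halving it leaves no remainder. *)
  rewrite def_k divn2 -[LHS]odd_double_half.
  by move: p_odd; rewrite -{1}(prednK (prime_gt0 p_prime)) /= => /negPf->.
have cardF : #|'F_p|.-1 = k.*2 by rewrite card_Fp.
have k_gt0 : (0 < k)%N by rewrite -double_gt0 -pred_p -subn1 subn_gt0 ltnW.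
rewrite /legendre /exp_symbol (dvdz_pcharf (pchar_Fp p_prime)).
rewrite !eqz_mod_Fp // rmorphXn rmorphN !mulr1z /=.
have [a0|a_neq0] := eqVneq.
  (* Since [k > 0], [0 ^+ k] is [0] and not [1], so both tests of [exp_symbol] fail. *)
  by rewrite a0 expr0n gtn_eqF //= eq_sym oppr_eq0 oner_eq0; split.
(* From here on both symbols branch on the same boolean. *)
have <- : (a%:~R ^+ k == 1 :> 'F_p) = is_square_mod a p.
  by apply/(finField_sqrtP cardF a_neq0)/is_square_mod_Fp.
have /orP[->|ak_N1] := finField_expf_half cardF a_neq0.
  by split=> // /eqP; rewrite eqz_mod_Fp // rmorph0 (negPf a_neq0).
rewrite ak_N1; split; try by case: ifP.
by move/eqP; rewrite eqz_mod_Fp // rmorph0 (negPf a_neq0).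
Qed.
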